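(* Let $G$ be an abelian topological group and let $\hat{G}$ be its dual group, i.e. the group of continuous homomorphisms $G\to\mathbb{T}$ endowed with the compact-open topology. (1) If $G$ is productively Fréchet and $\hat{G}$ is Fréchet-Urysohn, then $\hat{G}$ is metrizable and locally compact. (2) If $G$ is Fréchet-Urysohn and $\hat{G}$ is productively Fréchet, then $\hat{G}$ is metrizable and locally compact.
   Context: $\mathbb{T}$ denotes the one-dimensional torus (circle group). A topological space $X$ is Fréchet-Urysohn (or simply Fréchet) if whenever $x\in X$, $A\subseteq X$ and $x\in\mathrm{cl}\,A$, there is a sequence in $A$ converging to $x$. Two families $\mathcal{A},\mathcal{B}$ of subsets of a set $X$ mesh, written $\mathcal{A}\#\mathcal{B}$, if $A\cap B\neq\varnothing$ for all $A\in\mathcal{A}$, $B\in\mathcal{B}$. Filters on $X$ are ordered by inclusion; two filters $\mathcal{F},\mathcal{G}$ have a supremum $\mathcal{F}\vee\mathcal{G}$ if and only if $\mathcal{F}\#\mathcal{G}$. A sequence $(x_n)_{n\in\omega}$ is identified with the filter generated by its tails. $\mathbb{F}_1$ denotes the class of countably based filters (filters with a countable base). For a filter $\mathcal{H}$ on a topological space $X$, $\mathrm{adh}\,\mathcal{H}:=\bigcap_{H\in\mathcal{H}}\mathrm{cl}\,H$, and $\mathrm{adh}_{\mathrm{Seq}}\mathcal{H}:=\bigcup_{(x_n)_n\#\mathcal{H}}\lim(x_n)_n$ is the set of all limits of convergent sequences meshing with $\mathcal{H}$. A filter $\mathcal{F}$ on $X$ is strongly Fréchet if for every $\mathcal{H}\in\mathbb{F}_1$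 with $\mathcal{H}\#\mathcal{F}$ there is $\mathcal{G}\in\mathbb{F}_1$ with $\mathcal{G}\supseteq\mathcal{H}\vee\mathcal{F}$. A topological space $X$ is productively Fréchet if $\mathrm{adh}\,\mathcal{H}\subseteq\mathrm{adh}_{\mathrm{Seq}}\mathcal{H}$ for every strongly Fréchet filter $\mathcal{H}$ on $X$. *)

(* Defs.v *)
From HB Require Import structures.
From mathcomp Require Import all_boot all_order all_algebra.
From mathcomp Require Import all_classical all_reals all_analysis.
From mathcomp.real_closed Require Import complex.
From mathcomp Require Import ring.

Set Implicit Arguments.
Unset Strict Implicit.
Unset Printing Implicit Defensive.

Import Order.TTheory GRing.Theory Num.Theory.
Import numFieldNormedType.Exports.

Local Open Scope classical_set_scope.
Local Open Scope complex_scope.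
Local Open Scope ring_scope.

Definition unit_circle (R : realType) : set R[i]^o := [set z | `|z| = 1].
Arguments unit_circle : clear implicits.
Definition circle (R : realType) : Type := unit_circle R.

HB.instance Definition _ (R : realType) :=
  Uniform.copy (circle R) (set_type (unit_circle R)).
HB.instance Definition _ (R : realType) :=
  SubType.copy (circle R) (set_type (unit_circle R)).

Section circle_group.
Context {R : realType}.
Implicit Types z w : circle R.

Lemma circle_norm z : `|\val z| = 1. Proof. exact: (set_mem (valP z)). Qed.

Lemma circle_neq0 z : \val z != 0.
Proof. by rewrite -normr_eq0 circle_norm oner_eq0. Qed.

Lemma circle_mul_subproof z w : unit_circle R (\val z * \val w).
Proof. by rewrite /unit_circle/= normrM !circle_norm mulr1. Qed.

Lemma circle_inv_subproof z : unit_circle R (\val z)^-1.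
Proof. by rewrite /unit_circle/= normfV circle_norm invr1. Qed.

Lemma circle_one_subproof : unit_circle R 1.
Proof. by rewrite /unit_circle/= normr1. Qed.

Definition circle_mul z w : circle R :=
  SigSub (mem_set (circle_mul_subproof z w)).
Definition circle_inv z : circle R :=
  SigSub (mem_set (circle_inv_subproof z)).
Definition circle_one : circle R := SigSub (mem_set circle_one_subproof).

Lemma circle_mulA : associative circle_mul.
Proof. by move=> x y z; apply: val_inj; rewrite /= mulrA. Qed.
Lemma circle_mulC : commutative circle_mul.
Proof. by move=> x y; apply: val_inj; rewrite /= mulrC. Qed.
Lemma circle_mul1 : left_id circle_one circle_mul.
Proof. by move=> x; apply: val_inj; rewrite /= mul1r. Qed.
Lemma circle_mulV : left_inverse circle_one circle_inv circle_mul.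
Proof. by move=> x; apply: val_inj; rewrite /= mulVf// circle_neq0. Qed.

(* Topological abelian groups are additive in the library, so the group law   *)
(* [+%R] of [circle R] is complex multiplication and its [0] is the number 1. *)
HB.instance Definition _ := GRing.isZmodule.Build (circle R)
  circle_mulA circle_mulC circle_mul1 circle_mulV.

HB.instance Definition _ := isPointed.Build (circle R) 0.

Lemma val_circleD z w : \val (z + w) = \val z * \val w. Proof. by []. Qed.
Lemma val_circleN z : \val (- z) = (\val z)^-1. Proof. by []. Qed.

Lemma circle_entourageP (E : set (circle R * circle R)) :
  entourage E <-> exists2 e : R[i], 0 < e &
    forall z w, `|\val z - \val w| < e -> E (z, w).
Proof.
split.
  case=> V; rewrite -entourage_ballE => -[e /= e0 eV] VE.
  exists e => // z w zw; apply: VE => /=; apply: eV => /=.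
  by rewrite -ball_normE/= !set_valE.
move=> [e e0 eE]; exists [set xy | ball xy.1 e xy.2].
  by rewrite -entourage_ballE; exists e.
by move=> [z w]; rewrite /= -ball_normE/= !set_valE => /eE.
Qed.

Lemma circle_dist_sub (a b c d : circle R) :
  `|\val (a - b) - \val (c - d)| <= `|\val a - \val c| + `|\val b - \val d|.
Proof.
rewrite !val_circleD !val_circleN.
have -> : \val a / \val b - \val c / \val d =
    (\val a - \val c) / \val b +
    \val c * ((\val b)^-1 * (\val d)^-1) * (\val d - \val b).
  by field; rewrite !circle_neq0.
rewrite (le_trans (ler_normD _ _))// !normrM !normfV !circle_norm.
by rewrite !(invr1, mulr1, mul1r) [`|\val d - _|]distrC.
Qed.

Lemma circle_sub_continuous :
  continuous (fun x : circle R * circle R => x.1 - x.2).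
Proof.
move=> [a b] U /= /nbhsP[E /circle_entourageP[e e0 eE] EU].
have E2 : @entourage (circle R) [set xy | `|\val xy.1 - \val xy.2| < e / 2].
  by apply/circle_entourageP; exists (e / 2) => //; rewrite divr_gt0.
exists (xsection [set xy | `|\val xy.1 - \val xy.2| < e / 2] a,
        xsection [set xy | `|\val xy.1 - \val xy.2| < e / 2] b).
  by split; apply/nbhsP; exists [set xy | `|\val xy.1 - \val xy.2| < e / 2].
move=> [c d] [/= /xsectionP/= ac /xsectionP/= bd]; apply: EU; apply/xsectionP.
apply: eE; rewrite (le_lt_trans (circle_dist_sub _ _ _ _))//.
by rewrite [ltRHS]splitr ltrD.
Qed.

HB.instance Definition _ :=
  PreTopologicalNmodule_isTopologicalZmodule.Build (circle R)
    circle_sub_continuous.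

End circle_group.

Section dual_group.
Context (R : realType) (G : topologicalZmodType).

Definition characters : set {compact-open, G -> circle R} :=
  [set chi : G -> circle R | continuous chi /\ {morph chi : x y / x + y}].

(* The coercion [set_type] equips [dual] with the topology induced by the     *)
(* compact-open topology.                                                     *)
Definition dual : Type := characters.

HB.instance Definition _ := Topological.copy dual (set_type characters).
HB.instance Definition _ := SubType.copy dual (set_type characters).

Implicit Types f g h : dual.

Definition dual_fun f : G -> circle R := \val f.

Lemma dual_continuous f : continuous (dual_fun f).
Proof. by have [] := set_mem (valP f). Qed.

Lemma dualD f : {morph dual_fun f : x y / x + y}.
Proof. by have [] := set_mem (valP f). Qed.

Lemma dual_sub_subproof f g :
  characters (fun x => dual_fun f x - dual_fun g x).
Proof.
split=> [x|x y]; last by rewrite !dualD opprD addrACA.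
have cf : dual_fun f @ x --> dual_fun f x := @dual_continuous f x.
have cg : dual_fun g @ x --> dual_fun g x := @dual_continuous g x.
exact: (cvg_comp _ (fun z : circle R * circle R => z.1 - z.2)
  (cvg_pair cf cg) (@sub_continuous (circle R) (_, _))).
Qed.

Lemma dual_zero_subproof : characters (fun=> 0).
Proof. by split=> [x|x y]; [exact: cvg_cst|rewrite addr0]. Qed.

Definition dual_zero : dual := SigSub (mem_set dual_zero_subproof).
Definition dual_sub f g : dual := SigSub (mem_set (dual_sub_subproof f g)).
Definition dual_opp f : dual := dual_sub dual_zero f.
Definition dual_add f g : dual := dual_sub f (dual_opp g).

Lemma dual_inj f g : dual_fun f =1 dual_fun g -> f = g.
Proof. by move=> fg; apply: val_inj; apply/funext. Qed.

Lemma dual_addE f g x : dual_fun (dual_add f g) x = dual_fun f x + dual_fun g x.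
Proof. by rewrite /dual_fun/= /dual_fun/= /dual_fun/= sub0r opprK. Qed.

Lemma dual_oppE f x : dual_fun (dual_opp f) x = - dual_fun f x.
Proof. by rewrite /dual_fun/= /dual_fun/= sub0r. Qed.

Lemma dual_addA : associative dual_add.
Proof. by move=> f g h; apply: dual_inj => x; rewrite !dual_addE addrA. Qed.
Lemma dual_addC : commutative dual_add.
Proof. by move=> f g; apply: dual_inj => x; rewrite !dual_addE addrC. Qed.
Lemma dual_add0 : left_id dual_zero dual_add.
Proof. by move=> f; apply: dual_inj => x; rewrite dual_addE add0r. Qed.
Lemma dual_addN : left_inverse dual_zero dual_opp dual_add.
Proof.
by move=> f; apply: dual_inj => x; rewrite dual_addE dual_oppE addNr.
Qed.

HB.instance Definition _ := GRing.isZmodule.Build dual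
  dual_addA dual_addC dual_add0 dual_addN.

Lemma dualB f g x : dual_fun (f - g) x = dual_fun f x - dual_fun g x.
Proof. by rewrite [LHS]dual_addE dual_oppE. Qed.

Lemma compact_open_circleP (F : set_system (G -> circle R))
    (f : G -> circle R) : continuous f -> Filter F ->
  {compact-open, F --> f} <-> forall (K : set G) (e : R[i]), compact K -> 0 < e ->
    F [set g | forall x, K x -> `|\val (f x) - \val (g x)| < e].
Proof.
move=> cf FF; apply: (iff_trans (compact_open_fam_compactP cf FF)).
apply: (iff_trans (fam_cvgP _ _ FF)); split=> [Ff K e cK e0|Ff K cK U].
  apply: (Ff K cK); apply/uniform_nbhs.
  exists [set zw | `|\val zw.1 - \val zw.2| < e]; split => //.
  by apply/circle_entourageP; exists e.
move=> /uniform_nbhs[E [/circle_entourageP[e e0 eE] EU]].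
apply: filterS (Ff K e cK e0) => g gf; apply: EU => x Kx.
by apply: eE; exact: gf.
Qed.

Lemma dual_fun_continuous :
  continuous (dual_fun : dual -> {compact-open, G -> circle R}).
Proof.
have -> : dual_fun = @set_val _ characters by rewrite set_valE.
exact: initial_continuous.
Qed.

Lemma nbhs_dual_uniform f (K : set G) (e : R[i]) : compact K -> 0 < e ->
  nbhs f [set g | forall x, K x ->
    `|\val (dual_fun f x) - \val (dual_fun g x)| < e].
Proof.
move=> cK e0.
have fF : Filter (dual_fun @ nbhs f) by apply: fmap_filter.
have [+ _] := compact_open_circleP (@dual_continuous f) fF.
by move=> /(_ (@dual_fun_continuous f)); exact.
Qed.

Lemma dual_sub_continuous : continuous (fun x : dual * dual => x.1 - x.2).
Proof.
apply: (@continuous_comp_initial dual (dual * dual)%type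
  {compact-open, G -> circle R} set_val) => -[f g].
have -> : @set_val _ characters = dual_fun by rewrite set_valE.
set H := dual_fun \o _.
have HF : Filter (H @ nbhs (f, g)) by apply: fmap_filter.
have [_] := compact_open_circleP (@dual_continuous (f - g)) HF.
apply=> K e cK e0.
have e20 : 0 < e / 2 by rewrite divr_gt0.
exists ([set h | forall x, K x ->
           `|\val (dual_fun f x) - \val (dual_fun h x)| < e / 2],
        [set h | forall x, K x ->
           `|\val (dual_fun g x) - \val (dual_fun h x)| < e / 2]).
  by split; exact: nbhs_dual_uniform.
move=> [h k] [/= fh gk] x Kx.
suff : `|\val (dual_fun (f - g) x) - \val (dual_fun (h - k) x)| < e by [].
rewrite !dualB.
rewrite (le_lt_trans (circle_dist_sub _ _ _ _))//.
by rewrite [ltRHS]splitr ltrD// ?fh ?gk.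
Qed.

HB.instance Definition _ :=
  PreTopologicalNmodule_isTopologicalZmodule.Build dual dual_sub_continuous.

End dual_group.

Definition frechet_urysohn (X : topologicalType) :=
  forall (x : X) (A : set X), closure A x ->
    exists2 u : nat -> X, (forall n, A (u n)) & u @ \oo --> x.

Section filters.
Context {X : Type}.
Implicit Types F H : set_system X.

(* Filters are proper: the whole power set is not a filter. *)
Definition countably_based F :=
  ProperFilter F /\ exists2 B : set_system X, countable B & F = filter_from B id.

(* The supremum of two meshing filters. *)
Definition filter_join F H : set_system X :=
  filter_from (F `*` H) (fun P => P.1 `&` P.2).

Definition strongly_frechet F :=
  forall H, countably_based H -> H `#` F ->
    exists2 K : set_system X, countably_based K & filter_join H F `<=` K.

End filters.

Definition adh (X : topologicalType) (H : set_system X) : set X :=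
  \bigcap_(A in H) closure A.

(* [u @ \oo] is the filter generated by the tails of the sequence [u]. *)
Definition adh_seq (X : topologicalType) (H : set_system X) : set X :=
  [set x | exists2 u : nat -> X, (u @ \oo) `#` H & u @ \oo --> x].

Definition productively_frechet (X : topologicalType) :=
  forall H : set_system X, ProperFilter H -> strongly_frechet H ->
    adh H `<=` adh_seq H.

Definition metrizable (R : realType) (X : topologicalType) :=
  exists (M : metricType R) (f : X -> M) (g : M -> X),
    [/\ cancel f g, cancel g f, continuous f & continuous g].

(* Main.v *)
(** Call x in G and chi in the dual far when |chi x - 1| > 1/4.  A convergent
sequence together with its limit is compact, so sequences x_n --> 0 and
chi_n --> 0 cannot be far for every n.  Suppose that every neighbourhood of 0
in G and every neighbourhood W of 0 in the dual contain a far pair.  The sets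
[{x | x is far from some chi in W}] generate a filter with adherent point 0; it
is strongly Frechet because a Frechet abelian group satisfies the diagonal
property [frechet_diagonal] (Nyikos).  When G is productively Frechet this
filter meshes with a sequence tending to 0, and a second use of the diagonal
property gives far sequences, a contradiction.  The roles of the two groups can
be exchanged, so in both cases some neighbourhood U of 0 in G has a polar that
is a neighbourhood of 0; polars are compact by Ascoli's theorem.

Metrizability comes from a free sequence argument.  If no countable subset of G
separates the characters in a small compact subgroup N of the polar, then a
well-ordering of G gives an uncountable J in G with countable initial segments
and characters chi_d in N, d in J, trivial on J below d and bounded away from 1
on J from d on.  A cluster point of the chi_d along the co-countable filter is
trivial on J, but if it is the limit of some chi_(d_n), it is nontrivial at any
e in J above all the d_n.  So 0 has a countable base, and the dual is
metrizable by the Birkhoff-Kakutani theorem. *)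
From HB Require Import structures.
Require Import Defs.
From mathcomp Require Import all_boot all_order all_algebra.
From mathcomp Require Import all_classical all_reals all_analysis.
From mathcomp.classical Require Import wochoice.
From mathcomp.real_closed Require Import complex.
From mathcomp Require Import ring lra.

Set Implicit Arguments.
Unset Strict Implicit.
Unset Printing Implicit Defensive.

Import Order.TTheory GRing.Theory Num.Theory.
Import numFieldNormedType.Exports.

Local Open Scope classical_set_scope.
Local Open Scope complex_scope.
Local Open Scope ring_scope.

(** * Frechet and productively Frechet spaces *)

Lemma countable_surj_nat (T : Type) (A : set T) : countable A -> A !=set0 ->
  exists e : nat -> T, range e = A.
Proof.
move=> /countable_injP[f finj] [a Aa].
have eP n : exists x, A x /\ forall y, A y -> f y = n -> x = y.
  have [[y [Ay fy]]|nex] := pselect (exists y, A y /\ f y = n).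
    exists y; split => // z Az fz.
    by apply: finj; rewrite ?inE// fy fz.
  by exists a; split => // y Ay fy; case: nex; exists y.
exists (fun n => projT1 (cid (eP n))); rewrite predeqE => x; split.
  by move=> [n _ <-]; case: cid => y [].
by move=> Ax; exists (f x) => //; case: cid => y /= [_ yx]; exact: yx.
Qed.

Section filters.
Context {X : Type}.

Lemma countably_based_tails (u : nat -> X) : countably_based (u @ \oo).
Proof.
split; first exact: fmap_proper_filter.
exists (range (fun N => [set u n | n in [set n | (N <= n)%N]])).
  by apply: (sub_countable (card_image_le _ _)); exact: countableP.
rewrite predeqE => A; split.
  move=> [N _ NA]; exists [set u n | n in [set n | (N <= n)%N]] => /=.
    by exists N.
  by move=> _ [n /= Nn <-]; exact: NA.
move=> [_ [N _ <-]] /= NA; exists N => //= n /= Nn.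
by apply: NA; exists n.
Qed.

(** Finite intersections of the first members of an enumerated base give a decreasing base. *)
Lemma countably_based_decreasing (H : set_system X) : countably_based H ->
  exists L : nat -> set X, [/\ forall n, H (L n),
    forall m n, (m <= n)%N -> L n `<=` L m &
    forall A, H A -> exists n, L n `<=` A].
Proof.
move=> [HP [B cB HE]].
have B0 : B !=set0.
  have : H setT by exact: filterT.
  by rewrite HE => -[A BA _]; exists A.
have [e eB] := countable_surj_nat cB B0.
have He n : H (e n) by rewrite HE; exists (e n) => //; rewrite -eB; exists n.
exists (fun n => \bigcap_(i in `I_n.+1) e i); split.
- elim=> [|n IH]; first by apply: filterS (He 0) => x ex i /=; case: i.
  apply: filterS (filterI IH (He n.+1)) => x [Lx ex] i /=.
  by rewrite ltnS leq_eqVlt => /predU1P[->|]//; exact: Lx.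
- by move=> m n mn x Lx i /= im; apply: Lx; rewrite /= (leq_trans im).
- move=> A; rewrite HE => -[_ /[!(esym eB)] -[n _ <-] /= nA].
  by exists n => x /(_ n (ltnSn n)) /nA.
Qed.

End filters.

(** The definition is applied to the principal filter of [A]. Its join with a countably based filter
    is generated by the traces on [A] of a countable base, so it is strongly Frechet. A sequence
    that meshes with it is in [A] for arbitrarily large indices. *)
Lemma productively_frechet_urysohn (X : topologicalType) :
  productively_frechet X -> frechet_urysohn X.
Proof.
move=> pX x A clA.
have A0 : A !=set0 by have [y [Ay _]] := clA setT filterT; exists y.
pose H : set_system X := [set B | A `<=` B].
have HP : ProperFilter H.
  split; first by move=> A0'; have [y /A0'] := A0.
  split => //= [P Q AP AQ y Ay|P Q PQ AP].
    by split; [exact: AP|exact: AQ].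
  exact: subset_trans AP PQ.
have Hs : strongly_frechet H.
  move=> L cL LH; have [[_ LF] [B cB LE]] := cL.
  exists (filter_join L H); last by [].
  split.
    apply: filter_from_proper => [|[P Q] [/= LP HQ]]; last exact: (LH P Q).
    apply: filter_from_filter.
      exists (setT, setT) => //.
      by split; [exact: (@filterT _ L)|exact: (@filterT _ H)].
    move=> [P Q] [P' Q'] [/= LP HQ] [/= LP' HQ'].
    exists (P `&` P', Q `&` Q').
      by split; [exact: (filterI LP LP')|exact: (filterI HQ HQ')].
    by move=> y [/= [Py P'y] [Qy Q'y]]; split; split.
  exists [set P `&` A | P in B].
    exact: (sub_countable (card_image_le _ _)).
  rewrite predeqE => C; split.
    move=> [[P Q] [/= LP' AQ] PQC].
    move: LP'; rewrite LE => -[D BD DP].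
    exists (D `&` A); first by exists D.
    by move=> y [/DP Py /AQ Qy]; exact: PQC.
  move=> [_ [P BP <-]] /= PAC; exists (P, A) => //=.
  by split => //; rewrite LE; exists P.
have [|u uH ux] := pX H HP Hs x.
  by move=> B AB; exact: closure_subset clA.
have uA N : exists n, (N <= n)%N /\ A (u n).
  have [|//|_ [[n /= Nn <-] An]] := uH [set u n | n in [set n | (N <= n)%N]] A.
    by exists N => // n /= Nn; exists n.
  by exists n.
pose k N := projT1 (cid (uA N)).
exists (u \o k) => [n|]; first by rewrite /k /=; case: cid => ? /= [].
apply: cvg_comp ux; move=> B [N _ NB]; exists N => //= n /= Nn.
by apply: NB => /=; rewrite /k; case: cid => m /= [km _]; exact: leq_trans km.
Qed.

(* With z_n --> 0 such that z_n + V_n misses V_n, the point 0 is adherent to the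
   union of the z_n + (B_n `&` V_n); a sequence in this union that tends to 0
   meets each z_n + V_n finitely often.  Such z_n exist unless the closure of
   {0} is open (Y need not be Hausdorff); then y_n is taken in that closure. *)
Lemma frechet_diagonal (Y : topologicalZmodType) (B : nat -> set Y) :
  frechet_urysohn Y ->
  (forall m n, (m <= n)%N -> B n `<=` B m) ->
  (forall n, closure (B n) 0) ->
  exists2 y : nat -> Y, (forall n, B n (y n)) & y @ \oo --> (0 : Y).
Proof.
move=> fY Bdec B0.
pose N : set Y := [set z | forall O, nbhs (0 : Y) O -> O z].
have [clN|] := pselect (closure (~` N) 0); last first.
  move=> /existsNP[U /not_implyP[nU UN]].
  have UNN : U `<=` N.
    by move=> z Uz; apply: contrapT => Nz; apply: UN; exists z.
  have BN n : exists2 z, B n z & N z.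
    by have [z [Bz /UNN Nz]] := B0 n U nU; exists z.
  exists (fun n => projT1 (cid2 (BN n))) => [n|W nW]; first by case: cid2.
  by exists 0%N => // n _ /=; case: cid2 => z /= Bz; exact.
have [z zN z0] := fY _ _ clN.
have VP n : exists V, [/\ nbhs (0 : Y) V &
    forall v w, V v -> V w -> z n + v <> w].
  have /existsNP[U /not_implyP[nU Uz]] := zN n.
  have : nbhs ((0 : Y) - 0) U by rewrite subr0.
  move=> /(@sub_continuous Y (0, 0))[[V W] [/= nV nW] VWU].
  exists (V `&` W); split; first exact: filterI.
  move=> v w [Vv Wv] [Vw Ww] zvw; apply: Uz.
  by have := VWU (w, v) (conj Vw Wv); rewrite /= -zvw addrK.
pose V n := projT1 (cid (VP n)).
have nV n : nbhs (0 : Y) (V n) by rewrite /V; case: cid => ? /= [].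
have zV n v w : V n v -> V n w -> z n + v <> w.
  by rewrite /V; case: cid => ? /= [_]; exact.
pose A : set Y := [set a | exists n, exists2 v, (B n `&` V n) v & a = z n + v].
have clA : closure A 0.
  move=> O nO.
  have : nbhs ((0 : Y) + 0) O by rewrite addr0.
  move=> /(@add_continuous Y (0, 0))[[P Q] [/= nP nQ] PQO].
  have [n _ nzP] := z0 P nP.
  have [v [Bv [Qv Vv]]] := B0 n (Q `&` V n) (filterI nQ (nV n)).
  exists (z n + v); split; first by exists n, v.
  by apply: (PQO (z n, v)); split => //; exact: nzP n (leqnn n).
have [a Aa a0] := fY _ _ clA.
pose m k := projT1 (cid (Aa k)).
have mP k : exists2 v, (B (m k) `&` V (m k)) v & a k = z (m k) + v.
  by rewrite /m; case: cid.
pose b k := projT1 (cid2 (mP k)).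
have bB k : (B (m k) `&` V (m k)) (b k) by rewrite /b; case: cid2.
have abz k : a k = z (m k) + b k by rewrite /b; case: cid2.
have moo n : \forall k \near \oo, (n <= m k)%N.
  elim: n => [|n IH]; first exact: nearW.
  have := a0 (V n) (nV n); apply: (filterS2 _ _ IH) => k nk Vak.
  rewrite /= ltn_neqAle nk andbT; apply/eqP => nm.
  by have [_ Vb] := bB k; rewrite -nm in Vb; apply: (zV n _ _ Vb Vak);
    rewrite abz -nm.
have b0 : b @ \oo --> (0 : Y).
  have bE : b = (fun k => a k - z (m k)).
    by apply/funext => k; rewrite abz addrC addKr.
  have zm : z (m k) @[k --> \oo] --> (0 : Y).
    apply: cvg_comp z0; move=> C [k _ kC]; apply: filterS (moo k) => i ki.
    exact: kC.
  rewrite bE -[X in _ --> X](subr0 (0 : Y)).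
  exact: (cvg_comp _ (fun z : Y * Y => z.1 - z.2)
    (cvg_pair a0 zm) (@sub_continuous Y (_, _))).
(* The first bound puts [b k] in [B n], as [B] is decreasing; the second keeps the reindexed
   sequence convergent. *)
have kP n : exists k, (n <= m k)%N /\ (n <= k)%N.
  have [k [nk mk]] := filter_ex (filterI (nbhs_infty_ge n) (moo n)).
  by exists k.
pose k n := projT1 (cid (kP n)).
exists (b \o k) => [n|].
  rewrite /k /=; case: cid => i /= [nm _].
  by have [+ _] := bB i; exact: Bdec.
apply: cvg_comp b0; move=> C [i _ iC]; exists i => //= n /= ni.
by apply: iC; rewrite /= /k; case: cid => j /= [_]; exact: leq_trans.
Qed.

(** Stated for an abstract relation [D] so that the group and its dual can take either role. Only
    [Y] needs a group structure, for the diagonal property. *)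
Lemma nbhs_disjoint_rel (X : topologicalType) (Y : topologicalZmodType) (a : X)
    (D : X -> Y -> Prop) :
  productively_frechet X -> frechet_urysohn Y ->
  (forall (x : nat -> X) (y : nat -> Y), x @ \oo --> a -> y @ \oo --> (0 : Y) ->
     exists n, ~ D (x n) (y n)) ->
  exists U W, [/\ nbhs a U, nbhs (0 : Y) W & forall x y, U x -> W y -> ~ D x y].
Proof.
move=> pX fY nD; apply: contrapT => nUW.
have DUW U W : nbhs a U -> nbhs (0 : Y) W -> exists x y, [/\ U x, W y & D x y].
  move=> nU nW; apply: contrapT => nex; apply: nUW; exists U, W; split => //.
  by move=> x y Ux Wy Dxy; apply: nex; exists x, y.
pose E (W : set Y) := [set x | exists2 y, W y & D x y].
pose H : set_system X := filter_from (nbhs (0 : Y)) E.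
have HP : ProperFilter H.
  apply: filter_from_proper.
    apply: filter_from_filter; first by exists setT; exact: filterT.
    move=> V W nV nW; exists (V `&` W); first exact: filterI.
    by move=> x [y [Vy Wy] Dxy]; split; exists y.
  move=> W nW; have [x [y [_ Wy Dxy]]] := DUW setT W filterT nW.
  by exists x, y.
have Hs : strongly_frechet H.
  move=> L cL LH; have [L_ [LL Ldec Lsub]] := countably_based_decreasing cL.
  (* Since [L] meshes with [H], the point 0 is adherent to each [B n]. The diagonal property gives
     [y n] tending to 0 with partners [x n] in [L_ n], and the tails of [x] refine the join. *)
  pose B n := [set y | exists2 x, L_ n x & D x y].
  have [|n W nW|y By y0] := @frechet_diagonal Y B fY.
  - by move=> m n mn z [x Lx Dxz]; exists x => //; exact: Ldec Lx.
  - have [|x [Lx [y Wy Dxy]]] := LH (L_ n) (E W) (LL n); first by exists W.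
    by exists y; split => //; exists x.
  pose x n := projT1 (cid2 (By n)).
  exists (x @ \oo); first exact: countably_based_tails.
  move=> C [[P Q] [/= LP [W nW WQ]] PQC].
  have [m mP] := Lsub P LP.
  have := y0 W nW; move=> [k _ kW].
  exists (maxn m k) => // n /=; rewrite geq_max => /andP[mn kn].
  apply: PQC; rewrite /x; case: cid2 => z Lz Dzy; split => /=.
    by apply: mP; exact: Ldec Lz.
  by apply: WQ; exists (y n) => //; exact: kW.
have [|u uH ua] := pX H HP Hs a.
  move=> A [W nW WA] U nU; have [x [y [Ux Wy Dxy]]] := DUW U W nU nW.
  by exists x; split => //; apply: WA; exists y.
(* Here meshing of [u] with [H] makes 0 adherent to each [B N]. The diagonal sequence [y] is then
   related by [D] to terms of [u] of growing index. *)
pose B N := [set y | exists2 n, (N <= n)%N & D (u n) y].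
have [||y By y0] := @frechet_diagonal Y B fY.
- by move=> m n mn z [k nk Dk]; exists k => //; exact: leq_trans nk.
- move=> N W nW.
  have [| |x [[n /= Nn <-] [y Wy Dxy]]] :=
    uH [set u n | n in [set n | (N <= n)%N]] (E W).
  + by exists N => // n /= Nn; exists n.
  + by exists W.
  + by exists y; split => //; exists n.
pose k n := projT1 (cid2 (By n)).
have ku : (u \o k) @ \oo --> a.
  apply: cvg_comp ua; move=> C [N _ NC]; exists N => //= n /= Nn.
  by apply: NC => /=; rewrite /k; case: cid2 => m /= km _; exact: leq_trans km.
have [n] := nD _ _ ku y0; apply; rewrite /= /k; case: cid2 => //.
Qed.

(** * The Birkhoff-Kakutani theorem *)

Lemma nbhs_addl (M : topologicalZmodType) (a b : M) (U : set M) :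
  nbhs (a + b) U -> nbhs b [set x | U (a + x)].
Proof.
move=> /(@add_continuous M (a, b))[[V W] [/= nV nW] VWU].
apply: filterS nW => x Wx; apply: (VWU (a, x)); split => //.
exact: nbhs_singleton.
Qed.

Lemma nbhs_shiftP (M : topologicalZmodType) (a : M) (U : set M) :
  nbhs a U <-> nbhs (0 : M) [set x | U (a + x)].
Proof.
split=> [aU|]; first by apply: nbhs_addl; rewrite addr0.
rewrite -[X in nbhs X _ -> _](addNr a) => /nbhs_addl.
by apply: filterS => x /=; rewrite addNKr.
Qed.

(** The two proofs are phantom arguments on which the metric instance depends. The bound 2 makes the
    set of radii nonempty, so that its infimum is a genuine distance. *)
Definition metric_of (R : realType) (T : pseudoMetricType R)
  (_ : hausdorff_space T) (_ : forall x y : T, ball x 2 y) : Type := T.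

Section metric_of.
Context {R : realType} {T : pseudoMetricType R}.
Variables (hT : hausdorff_space T) (bT : forall x y : T, ball x 2 y).

Let dist_set (x y : T) : set R := [set e | 0 < e /\ ball x e y].
Let dist (x y : T) : R := inf (dist_set x y).

Let dist_set_lb x y : lbound (dist_set x y) 0.
Proof. by move=> e [/ltW]. Qed.

Let dist_set_has_inf x y : has_inf (dist_set x y).
Proof. by split; [exists 2 | exists 0; exact: dist_set_lb]. Qed.

Let dist_le x y e : 0 < e -> ball x e y -> dist x y <= e.
Proof. by move=> e0 xy; apply: ge_inf; [have [] := dist_set_has_inf x y|]. Qed.

Let dist_lt x y e : dist x y < e -> ball x e y.
Proof.
have [S0 _] := dist_set_has_inf x y; move=> /(inf_lt S0)[d [d0 xdy] de].
exact: le_ball (ltW de) _ xdy.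
Qed.

Let distxx x : dist x x = 0.
Proof.
apply/eqP; rewrite eq_le; apply/andP; split; last first.
  by apply: lb_le_inf => //; have [] := dist_set_has_inf x x.
by apply/ler_addgt0Pl => e e0; rewrite addr0; exact/dist_le/ballxx.
Qed.

Let dist_eq0 x y : dist x y = 0 -> x = y.
Proof.
move=> xy0; apply: hT => A B /nbhs_ballP[e /= e0 eA] /nbhs_ballP[d /= d0 dB].
by exists y; split; [apply/eA/dist_lt; rewrite xy0|exact/dB/ballxx].
Qed.

Let dist_sym x y : dist x y = dist y x.
Proof.
rewrite /dist; congr inf; apply/seteqP.
by split=> e [e0 /ball_sym].
Qed.

Let dist_triangle y x z : dist x z <= dist x y + dist y z.
Proof.
apply/ler_addgt0Pr => e e0.
have e20 : 0 < e / 2 by rewrite divr_gt0.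
have lt1 u v : dist u v < dist u v + e / 2 by rewrite ltrDl.
have d0 u v : 0 <= dist u v.
  by apply: lb_le_inf => //; have [] := dist_set_has_inf u v.
rewrite [in leRHS](splitr e) addrACA; apply: dist_le.
  by rewrite addr_gt0// ltr_wpDl.
by apply: ball_triangle; apply: dist_lt.
Qed.

HB.instance Definition _ := Choice.copy (metric_of hT bT) T.
HB.instance Definition _ := isMetric.Build R (metric_of hT bT)
  distxx dist_eq0 dist_sym dist_triangle.

Lemma pseudometric_metrizable : metrizable R T.
Proof.
exists (metric_of hT bT), id, id; split => //.
  (* A ball of radius [r] only bounds the distance by [r] in the weak sense, hence the halving. *)
  move=> x U /nbhs_ballP[e /= e0 eU]; apply/nbhs_ballP.
  exists (e / 2) => /=; first by rewrite divr_gt0.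
  move=> y xy; apply: eU; rewrite ballEmdist /=.
  apply: (@le_lt_trans _ _ (e / 2)).
    by apply: dist_le; rewrite // divr_gt0.
  by rewrite gtr_pMr// invf_lt1// ltr1n.
move=> x U /nbhs_ballP[e /= e0 eU]; apply/nbhs_ballP.
exists e => //= y; rewrite ballEmdist => xy; apply: eU; exact: dist_lt.
Qed.

End metric_of.

(** A copy of [M] with the translation-invariant uniformity: the entourages control the difference
    of the two coordinates. *)
Definition translation_uniform (M : topologicalZmodType) : Type := M.

Section translation_uniform.
Context {M : topologicalZmodType}.

Let ent : set_system (M * M) :=
  filter_from (nbhs (0 : M)) (fun U => [set xy | U (xy.2 - xy.1)]).

Let ent_filter : Filter ent.
Proof.
apply: filter_from_filter; first by exists setT; exact: filterT.
by move=> U V nU nV; exists (U `&` V) => //; exact: filterI.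
Qed.

Let ent_diagonal A : ent A -> diagonal `<=` A.
Proof.
move=> [U nU UA] [x y]; rewrite /diagonal/= => <-; apply: UA; rewrite /= subrr.
exact: nbhs_singleton.
Qed.

Let ent_inv A : ent A -> ent A^-1%relation.
Proof.
move=> [U nU UA]; have : nbhs (- (0 : M)) U by rewrite oppr0.
move=> /(@opp_continuous M) nNU; exists (-%R @^-1` U) => // -[x y] /= Uxy.
by apply: UA; rewrite /= -opprB.
Qed.

Let ent_split A : ent A -> exists2 B, ent B & (B \; B)%relation `<=` A.
Proof.
move=> [U nU UA]; have : nbhs ((0 : M) + 0) U by rewrite addr0.
move=> /(@add_continuous M (0, 0))[[V W] [/= nV nW] VWU].
exists [set xy | (V `&` W) (xy.2 - xy.1)].
  by exists (V `&` W) => //; exact: filterI.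
move=> [x y] [z /= [_ xz] [zy _]]; apply: UA => /=.
by rewrite -(subrK z y) -addrA; apply: (VWU (_, _)).
Qed.

Let nbhs_ent : nbhs = nbhs_ ent.
Proof.
apply/funext => x; apply/seteqP; split=> U.
  move=> /nbhs_shiftP nU.
  exists [set xy | U (x + (xy.2 - xy.1))]; first by exists [set z | U (x + z)].
  by move=> y /xsectionP/=; rewrite addrC subrK.
move=> [A [V nV VA] AU]; apply/nbhs_shiftP; apply: filterS nV => y Vy.
by apply: AU; apply/xsectionP; apply: VA; rewrite /= addrAC subrr add0r.
Qed.

HB.instance Definition _ := Topological.copy (translation_uniform M) M.
HB.instance Definition _ := Nbhs_isUniform_mixin.Build (translation_uniform M)
  ent_filter ent_diagonal ent_inv ent_split nbhs_ent.

Lemma translation_countable_uniformity (V : nat -> set M) :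
  (forall n, nbhs (0 : M) (V n)) ->
  (forall U, nbhs (0 : M) U -> exists n, V n `<=` U) ->
  countable_uniformity (translation_uniform M).
Proof.
move=> nV Vb; apply/countable_uniformityP.
exists (fun n => [set xy : M * M | V n (xy.2 - xy.1)]).
  by move=> A [U /Vb[n VU] UA]; exists n => xy /VU /UA.
by move=> n; exists (V n).
Qed.

(** A countable base at 0 yields a countable base of entourages, hence a pseudometric whose balls of
    radius 2 are the whole space; separation makes it a metric. *)
Lemma first_countable_metrizable (R : realType) (V : nat -> set M) :
  hausdorff_space M -> (forall n, nbhs (0 : M) (V n)) ->
  (forall U, nbhs (0 : M) U -> exists n, V n `<=` U) -> metrizable R M.
Proof.
move=> hM nV Vb; have cu := translation_countable_uniformity nV Vb.
have hT : hausdorff_space (countable_uniform cu) by exact: hM.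
exact: (pseudometric_metrizable hT
  (@countable_uniform.countable_uniform_bounded R _ cu)).
Qed.

End translation_uniform.

(** * The circle *)

Section circle.
Context {R : realType}.
Implicit Types z w : circle R.

Definition circle_val z : R[i] := \val z.

Lemma circle_val_norm z : `|circle_val z| = 1.
Proof. exact: circle_norm. Qed.

Lemma circle_val_neq0 z : circle_val z != 0.
Proof. exact: circle_neq0. Qed.

Lemma circle_valD z w : circle_val (z + w) = circle_val z * circle_val w.
Proof. by []. Qed.

Lemma circle_valN z : circle_val (- z) = (circle_val z)^-1.
Proof. by []. Qed.

(** Chord length from [z] to the neutral element. The norm of [R[i]] has values in [R[i]]; the real
    part turns it into a real number. *)
Definition circle_dist z : R := complex.Re `|circle_val z - 1|.

Lemma circle_distC z : (circle_dist z)%:C = `|circle_val z - 1|.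
Proof. by rewrite RRe_real// ger0_real. Qed.

Lemma circle_distE z w : `|\val z - \val w| = (circle_dist (z - w))%:C.
Proof.
suff : `|circle_val z - circle_val w| = (circle_dist (z - w))%:C by [].
have -> : circle_val z - circle_val w = circle_val w * (circle_val (z - w) - 1).
  by rewrite circle_valD circle_valN; field; rewrite circle_val_neq0.
by rewrite normrM circle_val_norm mul1r circle_distC.
Qed.

Lemma circle_dist_ge0 z : 0 <= circle_dist z.
Proof. by rewrite -lecR circle_distC; exact: normr_ge0. Qed.

Lemma circle_dist0 : circle_dist 0 = 0.
Proof. by apply: complexI; rewrite circle_distC subrr normr0. Qed.

Lemma circle_dist_eq0 z : circle_dist z = 0 -> z = 0.
Proof.
move=> z0; have /eqP := circle_distC z.
rewrite z0 eq_sym normr_eq0 subr_eq0 => /eqP z1; exact: val_inj.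
Qed.

Lemma circle_distN z : circle_dist (- z) = circle_dist z.
Proof.
by apply: complexI; rewrite -[- z]sub0r -circle_distE distrC circle_distE subr0.
Qed.

Lemma circle_distD z w : circle_dist (z + w) <= circle_dist z + circle_dist w.
Proof.
have := circle_dist_sub z (- w) 0 0.
by rewrite opprK !circle_distE !subr0 circle_distN -rmorphD lecR.
Qed.

(** In complex terms |z^2 - 1| = |z + 1| |z - 1|, and |z + 1| >= 2 - |z - 1| >= 3/2. *)
Lemma circle_dist_double z : circle_dist z <= 1 / 2 ->
  3 / 2 * circle_dist z <= circle_dist (z + z).
Proof.
move=> z2; have zz : circle_dist (z + z) =
    complex.Re `|circle_val z + 1| * circle_dist z.
  apply: complexI; rewrite rmorphM/= RRe_real ?ger0_real// !circle_distC.
  by rewrite -normrM circle_valD; congr `|_|; ring.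
rewrite zz ler_wpM2r ?circle_dist_ge0//.
have : 2%:R%:C <= `|circle_val z + 1| + `|circle_val z - 1|.
  have -> : 2%:R%:C = `|(circle_val z + 1) - (circle_val z - 1)|.
    rewrite (_ : _ - _ = 2%:R) ?normr_nat ?rmorph_nat//; ring.
  by rewrite (le_trans (ler_normB _ _)).
rewrite -circle_distC -[`|_|]RRe_real ?ger0_real// -rmorphD lecR; lra.
Qed.

(** Each doubling that starts within 1/2 expands the distance by 3/2. This one estimate yields both
    the absence of small subgroups and the equicontinuity of polars. *)
Lemma circle_dist_double_iter z n :
  (forall k, (k <= n)%N -> circle_dist (z *+ 2 ^ k) <= 1 / 2) ->
  (3 / 2) ^+ n * circle_dist z <= 1 / 2.
Proof.
move=> zn; apply: le_trans (zn n (leqnn n)).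
elim: n zn => [|n IH] zn; first by rewrite mul1r.
rewrite exprS -mulrA; apply: (@le_trans _ _ (3 / 2 * circle_dist (z *+ 2 ^ n))).
  by rewrite ler_pM2l// IH// => k kn; rewrite zn// ltnW.
by rewrite expnS mul2n -addnn mulrnDr; exact/circle_dist_double/zn.
Qed.

Lemma expr3half_unbounded (e : R) : 0 < e -> exists n, 1 / 2 < (3 / 2) ^+ n * e.
Proof.
(* Bernoulli's inequality. *)
move=> e0; have en n : 1 + n%:R / 2 <= (3 / 2) ^+ n :> R.
  elim: n => [|n IH]; first by rewrite expr0 mul0r addr0.
  rewrite exprS -natr1.
  apply: (@le_trans _ _ (3 / 2 * (1 + n%:R / 2))); last by rewrite ler_pM2l.
  by have : 0 <= n%:R :> R by []; lra.
exists (Num.bound e^-1).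
have := archi_boundP (ltW (_ : 0 < e^-1)); rewrite invr_gt0 => /(_ e0).
set n := Num.bound _ => eN.
have {}eN : 1 < n%:R * e by rewrite -ltr_pdivrMr// mul1r.
have : (1 + n%:R / 2) * e <= (3 / 2) ^+ n * e by rewrite ler_pM2r.
by rewrite mulrDl mul1r; lra.
Qed.

(** The circle has no small subgroups: if all multiples by powers of 2 stayed within 1/2, the
    distance of [z] would be 0. *)
Lemma circle_dist_large z : z != 0 -> exists n, 1 / 2 < circle_dist (z *+ n).
Proof.
move=> z0; apply: contrapT => nex.
have [|n] := expr3half_unbounded (_ : 0 < circle_dist z).
  rewrite lt_neqAle circle_dist_ge0 andbT eq_sym.
  by apply: contra_neq z0; exact: circle_dist_eq0.
rewrite ltNge => /negP; apply; apply: circle_dist_double_iter => k _.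
by rewrite leNgt; apply/negP => zk; apply: nex; exists (2 ^ k)%N.
Qed.

Lemma nbhs_circleP z (U : set (circle R)) : nbhs z U <->
  exists2 e, 0 < e & forall w, circle_dist (z - w) < e -> U w.
Proof.
split.
  move=> /nbhsP[E /circle_entourageP[e e0 eE] EU].
  have eR : e = (complex.Re e)%:C by rewrite RRe_real// gtr0_real.
  exists (complex.Re e); first by rewrite -ltcR -eR.
  by move=> w zw; apply/EU/xsectionP/eE; rewrite circle_distE eR ltcR.
move=> [e e0 eU]; apply/nbhsP.
exists [set zw | circle_dist (zw.1 - zw.2) < e]; last by move=> w /xsectionP/eU.
apply/circle_entourageP; exists e%:C; first by rewrite ltcR.
by move=> u w; rewrite circle_distE ltcR.
Qed.

Lemma nbhs_circle_ball z (e : R) : 0 < e ->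
  nbhs z [set w | circle_dist (z - w) < e].
Proof. by move=> e0; apply/nbhs_circleP; exists e. Qed.

Lemma circle_hausdorff : hausdorff_space (circle R).
Proof.
move=> z w zw; apply/eqP; rewrite -subr_eq0; apply/eqP/circle_dist_eq0.
apply/eqP; rewrite eq_le circle_dist_ge0 andbT leNgt; apply/negP => d0.
have d20 : 0 < circle_dist (z - w) / 2 by rewrite divr_gt0.
have [u []] := zw _ _ (nbhs_circle_ball z d20) (nbhs_circle_ball w d20).
rewrite /= -[circle_dist (w - u)]circle_distN opprB => zu uw.
have := circle_distD (z - u) (u - w); rewrite addrA subrK; lra.
Qed.

Lemma circle_dist_continuous : continuous circle_dist.
Proof.
move=> z U /nbhs_ballP[e /= e0 eU]; apply/nbhs_circleP; exists e => // w zw.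
apply: eU; rewrite -ball_normE /=; apply: le_lt_trans zw.
rewrite ler_norml lerBlDr.
have := circle_distD (z - w) w; rewrite subrK => ->.
rewrite andbT lerNl opprB lerBlDr.
have := circle_distD (w - z) z; rewrite subrK => /le_trans; apply.
by rewrite -(circle_distN (w - z)) opprB.
Qed.

Lemma cis_subproof (t : R) : unit_circle R (cos t +i* sin t).
Proof. by rewrite /unit_circle /= normc_def /= cos2Dsin2 sqrtr1. Qed.

Definition cis (t : R) : circle R := SigSub (mem_set (cis_subproof t)).

Lemma cis_continuous : continuous cis.
Proof.
move=> t U /nbhs_circleP[e e0 eU].
have e20 : 0 < e / 2 by rewrite divr_gt0.
suff : \forall s \near t, U (cis s) by [].
near=> s; apply: eU; rewrite -ltcR -circle_distE.
have -> : \val (cis t) - \val (cis s) =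
    (cos t - cos s)%:C + (sin t - sin s) *i.
  by rewrite /= /GRing.add/GRing.opp/=; congr Complex; rewrite ?addr0 ?add0r.
rewrite (le_lt_trans (ler_normD _ _))// !normc_def/= expr0n/= addr0 add0r.
rewrite !sqrtr_sqr -rmorphD ltcR [e]splitr ltrD//.
  near: s; have /cvgrPdist_lt := @continuous_cos R t; exact.
near: s; have /cvgrPdist_lt := @continuous_sin R t; exact.
Unshelve. all: by end_near. Qed.

Lemma cis_surj z : exists2 t, t \in `[- pi, pi] & cis t = z.
Proof.
have := circle_norm z; case zE : (\val z) => [a b]; rewrite normc_def/= => -[].
move=> /(congr1 (fun x => x ^+ 2)).
rewrite sqr_sqrtr ?addr_ge0 ?sqr_ge0// expr1n.
move=> ab1.
have a1 : -1 <= a <= 1 by apply/andP; split; nra.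
have sb : sin (acos a) = `|b|.
  by rewrite sin_acos// -sqrtr_sqr; congr Num.sqrt; lra.
have := acos_ge0 a1; have := acos_lepi a1; move=> api a0.
have pi0 := pi_ge0 R.
have [b0|b0] := leP 0 b.
  exists (acos a); first by rewrite in_itv/=; lra.
  by apply: val_inj; rewrite /= zE acosK ?in_itv// sb ger0_norm.
exists (- acos a); first by rewrite in_itv/=; lra.
by apply: val_inj; rewrite /= zE cosN sinN acosK ?in_itv// sb ltr0_norm// opprK.
Qed.

Lemma circle_compact : compact [set: circle R].
Proof.
have -> : [set: circle R] = cis @` `[- pi, pi].
  apply/esym/seteqP; split=> // z _.
  by have [t tpi tz] := cis_surj z; exists t.
apply: continuous_compact; last exact: segment_compact.
exact/continuous_subspaceT/cis_continuous.
Qed.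

End circle.

(** * Polars in the dual group *)

Lemma nbhs0_natmul (M : topologicalZmodType) (n : nat) (U : set M) :
  nbhs (0 : M) U -> nbhs (0 : M) [set x | U (x *+ n)].
Proof.
elim: n U => [|n IH] U nU.
  by apply: filterS filterT => x _ /=; rewrite mulr0n; exact: nbhs_singleton.
have : nbhs ((0 : M) + 0) U by rewrite addr0.
move=> /(@add_continuous M (0, 0))[[V W] [/= nV nW] VWU].
apply: filterS (filterI nV (IH _ nW)) => x [Vx Wx] /=; rewrite mulrS.
exact: (VWU (_, _)).
Qed.

Lemma ultra_fmap_cvg (S : Type) (T : topologicalType) (F : set_system S)
    (f : S -> T) : UltraFilter F -> compact [set: T] ->
  exists p : T, f @ F --> p.
Proof.
move=> UF cT; have PF : ProperFilter (f @ F).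
  by apply: fmap_proper_filter; exact: ultra_proper.
have [p [_ pc]] := cT (f @ F) PF filterT.
exists p => A nA; have [//|FA] := in_ultra_setVsetC (f @^-1` A) UF.
by have [x []] := pc (~` A) A FA nA.
Qed.

Section polar.
Context {R : realType} {G : topologicalZmodType}.
Local Notation dual := (dual R G).
Implicit Types (U : set G) (f g : dual).

Lemma nbhs_dual_compact f (K : set G) (e : R) : compact K -> 0 < e ->
  nbhs f [set g | forall x, K x ->
    circle_dist (dual_fun f x - dual_fun g x) < e].
Proof.
move=> cK e0; have eC : 0 < e%:C :> R[i] by rewrite ltcR.
apply: filterS (nbhs_dual_uniform f cK eC) => g fg x Kx.
by have := fg x Kx; rewrite circle_distE ltcR.
Qed.

Lemma dual_eval_continuous (x : G) : continuous (fun f => dual_fun f x).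
Proof.
move=> f A /nbhs_circleP[e e0 eA].
apply: filterS (nbhs_dual_compact f (@compact_set1 _ x) e0) => g fg.
by apply/eA/fg.
Qed.

Lemma dual_hausdorff : hausdorff_space dual.
Proof.
move=> f g fg; apply: dual_inj => x; apply: circle_hausdorff => A B nA nB.
have [h [Ah Bh]] := fg _ _ (dual_eval_continuous nA) (dual_eval_continuous nB).
by exists (dual_fun h x).
Qed.

Lemma dual0 x : dual_fun (0 : dual) x = 0. Proof. by []. Qed.

Lemma dual_funD f g x : dual_fun (f + g) x = dual_fun f x + dual_fun g x.
Proof. exact: dual_addE. Qed.

Lemma dual_natmul f x n : dual_fun (f *+ n) x = dual_fun f x *+ n.
Proof. by elim: n => [//|n IH]; rewrite !mulrS dual_funD IH. Qed.

Let additive_on U : set (G -> circle R) :=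
  [set phi : G -> circle R | {morph phi : x y / x + y} /\
             forall x, U x -> circle_dist (phi x) <= 1 / 4].

(** If 2^k (x - y) is in [U] for all k <= n, the doubling estimate bounds the distance of [phi x]
    and [phi y] by (2/3)^n / 2, uniformly in [phi]. *)
Let additive_equicontinuous U :
  nbhs (0 : G) U -> equicontinuous (additive_on U) id.
Proof.
move=> nU x E /circle_entourageP[e e0 eE].
have eR : e = (complex.Re e)%:C by rewrite RRe_real// gtr0_real.
have {}e0 : 0 < complex.Re e by rewrite -ltcR -eR.
have [n ne] := expr3half_unbounded e0.
pose V := \bigcap_(k in `I_n.+1) [set y | U (y *+ 2 ^ k)].
have nV : nbhs (0 : G) V.
  have : finite_set `I_n.+1 by [].
  rewrite /V => /finite_fsetP[D ->].
  by apply: filter_bigI => k _; exact: (@nbhs0_natmul G (2 ^ k) U nU).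
suff : nbhs x [set y | V (x - y)].
  apply: filterS => y Vxy phi [phiD phiU]; apply: eE.
  have phiN z k : phi (z *+ k) = phi z *+ k.
    have phi0 : phi 0 = 0.
      by apply: (@addIr _ (phi 0)); rewrite -phiD !add0r.
    by elim: k => [//|k IH]; rewrite !mulrS phiD IH.
  have phiB : phi (x - y) = phi x - phi y.
    by apply/eqP; rewrite eq_sym subr_eq -phiD subrK.
  rewrite circle_distE -phiB eR ltcR.
  have := @circle_dist_double_iter R (phi (x - y)) n.
  have le4 k : (k <= n)%N -> circle_dist (phi (x - y) *+ 2 ^ k) <= 1 / 2.
    by move=> kn; rewrite -phiN (le_trans (phiU _ (Vxy k _)))//; lra.
  move=> /(_ le4) le2; rewrite -(@ltr_pM2l _ ((3 / 2) ^+ n)) ?exprn_gt0//.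
  exact: le_lt_trans ne.
have nV' : nbhs (- (0 : G)) V by rewrite oppr0.
have nNV : nbhs (0 : G) [set y | V (- y)] := @opp_continuous G 0 V nV'.
apply/nbhs_shiftP; apply: filterS nNV => y Vy /=.
by rewrite opprD addrA subrr add0r.
Qed.

(** The usual polar with the right half circle replaced by a shorter arc, within the range 1/2 of
    the doubling estimate. *)
Definition polar U : set dual :=
  [set f | forall x, U x -> circle_dist (dual_fun f x) <= 1 / 4].

(** An ultrafilter on the polar converges pointwise because the circle is compact. Equicontinuity
    makes the limit a character and the convergence uniform on compact sets. *)
Lemma polar_compact U : nbhs (0 : G) U -> compact (polar U).
Proof.
move=> nU; rewrite compact_ultra => F UF FU.
have PF : ProperFilter F by exact: ultra_proper.
have /choice[phi phiF] x :=
  ultra_fmap_cvg (fun f => dual_fun f x) UF (@circle_compact R).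
have phiW : additive_on U phi.
  split=> [x y|x Ux].
    apply: (cvg_unique (@circle_hausdorff R) (phiF (x + y))).
    have -> : (fun f => dual_fun f (x + y)) =
        (fun f => dual_fun f x + dual_fun f y).
      by apply/funext => f; exact: dualD.
    exact: (cvg_comp _ (fun z : circle R * circle R => z.1 + z.2)
      (cvg_pair (phiF x) (phiF y)) (@add_continuous (circle R) (_, _))).
  apply: (@closed_cvg _ _ F _ (fun f => dual_fun f x)
      (fun z => circle_dist z <= 1 / 4) _ _ _ (phiF x)).
    exact: (closed_comp (fun z _ => @circle_dist_continuous R z)
      (@closed_le R (1 / 4))).
  by apply: filterS FU => f; exact.
have phic : continuous phi.
  exact: equicontinuous_continuous (additive_equicontinuous nU) phiW.
have phi_char : characters (phi : {compact-open, G -> circle R}).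
  by split => //; case: phiW.
pose chi : dual := SigSub (mem_set phi_char).
exists chi; split=> /=; first by case: phiW.
have FF : Filter (@dual_fun R G @ F) by exact: fmap_filter.
have PFF : ProperFilter (@dual_fun R G @ F) by exact: fmap_proper_filter.
have Fptws : {ptws, @dual_fun R G @ F --> phi} by apply/pointwise_cvgP.
have Feq : \forall W \near powerset_filter_from (@dual_fun R G @ F),
    equicontinuous W id.
  apply/near_powerset_filter_fromP; first exact: equicontinuous_subset_id.
  exists (additive_on U); last exact: (additive_equicontinuous nU).
  suff : F [set f | additive_on U (dual_fun f)] by [].
  apply: filterS FU => f Uf; split; last exact: Uf.
  by move=> x y; exact: (@dualD R G f x y).
have Fcpt : {family compact, @dual_fun R G @ F --> phi}.
  exact: (pointwise_compact_cvg phi PFF Feq).1.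
have Fphi : {compact-open, @dual_fun R G @ F --> phi}.
  exact/(compact_open_fam_compactP phic FF).
move=> A /= [_ [[B oB <-]]] /= Bchi /filterS; apply.
have valE : @set_val _ (characters (R := R) (G := G)) = @dual_fun R G.
  by rewrite set_valE.
by rewrite valE in Bchi *; apply: Fphi; exact: open_nbhs_nbhs.
Qed.

End polar.

(** * Countable bases in the dual group *)

Lemma countableU (T : Type) (A B : set T) :
  countable A -> countable B -> countable (A `|` B).
Proof.
move=> cA cB; rewrite -bigcup2E; apply: bigcup_countable => // -[|[|n]] _ //=.
Qed.

Lemma exists_well_order (T : choiceType) : exists le : rel T,
  [/\ reflexive le, transitive le, antisymmetric le, total le &
      forall A : set T, A !=set0 ->
        exists2 z, A z & forall x, A x -> le z x].
Proof.
have [le wo] := well_ordering_principle T.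
have leT : wo_chain le predT by move=> A _; exact: wo.
have tot : total le by move=> x y; exact: (wo_chainW leT).
have anti : antisymmetric le by move=> x y; exact: (wo_chain_antisymmetric leT).
have minA (A : set T) : A !=set0 -> exists2 z, A z & forall x, A x -> le z x.
  move=> [a Aa]; have [|z [[/set_mem Az zA] _]] := wo (mem A).
    by exists a; exact/mem_set.
  by exists z => // x Ax; apply: zA; exact/mem_set.
exists le; split => // [x|y x z xy yz]; first by have := tot x x; rewrite orbb.
(* Transitivity is read off the least of the three points: if it is not [x], antisymmetry identifies
   two of them. *)
have [|w [[->|->]|->]] := minA ([set x] `|` [set y] `|` [set z]).
- by exists x; left; left.
- by move=> /(_ z); apply; right.
- move=> /(_ x) yx; suff -> : x = y by [].
  by apply: anti; rewrite xy yx//; left; left.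
- move=> /(_ y) zy; suff <- : y = z by [].
  by apply: anti; rewrite yz zy//; left; right.
Qed.

(** Cut [A] at a minimal point whose initial segment in [A] is uncountable; if there is no such
    point, take [A] itself. *)
Lemma uncountable_initial (T : Type) (lt : T -> T -> Prop) (A : set T) :
  (forall B : set T, B !=set0 -> exists2 z, B z & forall x, B x -> ~ lt x z) ->
  ~ countable A ->
  exists J : set T, [/\ J `<=` A, ~ countable J &
    forall d, J d -> countable [set e | J e /\ lt e d]].
Proof.
move=> wf uA; pose B := [set d | A d /\ ~ countable [set e | A e /\ lt e d]].
have [/wf[d [Ad ud] dmin]|B0] := pselect (B !=set0).
  exists [set e | A e /\ lt e d]; split => // [e []//|e [Ae ed]].
  apply: contrapT => ue; apply: (dmin e) => //; split => //.
  apply: contra_not ue; apply: sub_countable; apply: subset_card_le.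
  by move=> x [[Ax _] xe].
exists A; split => // d Ad; apply: contrapT => ud.
by apply: B0; exists d.
Qed.

Lemma compact_finite_intersection (X : topologicalType) (I : eqType)
    (P : set X) (Q : I -> set X) :
  compact P -> (forall i, closed (Q i)) ->
  (forall s : seq I, exists2 x, P x & forall i, i \in s -> Q i x) ->
  exists2 x, P x & forall i, Q i x.
Proof.
move=> cP cQ fin.
pose B (s : seq I) := [set x | P x /\ forall i, i \in s -> Q i x].
pose F : set_system X := filter_from setT B.
have PF : ProperFilter F.
  apply: filter_from_proper => [|s _]; last first.
    by have [x Px xs] := fin s; exists x.
  apply: filter_from_filter; first by exists [::].
  move=> s t _ _; exists (s ++ t) => // x [Px xst].
  by split; split => // i ii; apply: xst; rewrite mem_cat ii ?orbT.
have [|x [Px Fx]] := cP F PF; first by exists [::] => // x [].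
exists x => // i; apply: (cQ i) => V nV.
have [|y [[_ /(_ i (mem_head _ _)) Qy] Vy]] := Fx (B [:: i]) V _ nV.
  by exists [:: i].
by exists y.
Qed.

Section dual_first_countable.
Context {R : realType} {G : topologicalZmodType}.
Local Notation dual := (dual R G).
Implicit Types (f g : dual) (x d e : G).

Let dist_eval_continuous x : continuous (fun f => circle_dist (dual_fun f x)).
Proof.
move=> f; apply: (@continuous_comp _ _ _ (fun f => dual_fun f x) circle_dist).
  exact: dual_eval_continuous.
exact: circle_dist_continuous.
Qed.

Let closed_dist_le x (r : R) :
  closed [set f : dual | circle_dist (dual_fun f x) <= r].
Proof.
exact: (closed_comp (fun f _ => @dist_eval_continuous x f) (@closed_le R r)).
Qed.

Let closed_dist_ge x (r : R) :
  closed [set f : dual | r <= circle_dist (dual_fun f x)].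
Proof.
exact: (closed_comp (fun f _ => @dist_eval_continuous x f) (@closed_ge R r)).
Qed.

Let closed_dual_eq0 x : closed [set f : dual | dual_fun f x = 0].
Proof.
rewrite (_ : mkset _ = [set f : dual | circle_dist (dual_fun f x) <= 0]).
  exact: closed_dist_le.
apply/seteqP; split => f /=; first by move=> ->; rewrite circle_dist0.
move=> f0; apply: circle_dist_eq0; apply/eqP.
by rewrite eq_le f0 circle_dist_ge0.
Qed.

Let closed_imply (p : Prop) (A : set dual) :
  closed A -> closed [set f | p -> A f].
Proof.
move=> cA; have [pp|np] := pselect p.
  by rewrite (_ : mkset _ = A)//; apply/seteqP; split => f /= => [|Af _]; auto.
rewrite (_ : mkset _ = setT); first exact: closedT.
by apply/seteqP; split => f _ //= /np.
Qed.

Variable P : set dual.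
Hypotheses (nP : nbhs (0 : dual) P) (cP : compact P).

(** Choose a neighbourhood [U] of 0 with [U + U] inside [P]. Only 0 is trivial on all of [G], so by
    compactness the characters in [P] trivial on a large enough finite set already lie in [U]. *)
Lemma local_subgroup : exists s : seq G, forall f g,
  P f -> (forall x, x \in s -> dual_fun f x = 0) ->
  P g -> (forall x, x \in s -> dual_fun g x = 0) -> P (f + g).
Proof.
have : nbhs ((0 : dual) + 0) P by rewrite addr0.
move=> /(@add_continuous dual (0, 0))[[V W] [/= nV nW] VWP].
pose U := V `&` W; have nU : nbhs (0 : dual) U by exact: filterI.
suff [s sU] : exists s : seq G, forall f,
    P f -> (forall x, x \in s -> dual_fun f x = 0) -> U f.
  exists s => f g Pf fs Pg gs; have [Vf _] := sU f Pf fs.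
  by have [_ Wg] := sU g Pg gs; exact: (VWP (f, g)).
apply: contrapT => nex.
have [x||f Pf Qf] := @compact_finite_intersection dual G P
    (fun x => [set f | dual_fun f x = 0] `&` ~` U°) cP.
- by apply: closedI => //; exact/open_closedC/open_interior.
- move=> s; apply: contrapT => ns; apply: nex; exists s => f Pf fs.
  apply: contrapT => Uf; apply: ns; exists f => // x xs; split; first exact: fs.
  by move=> /interior_subset.
- have f0 : f = 0 by apply: dual_inj => x; have [] := Qf x.
  by have [_] := Qf 0; apply; rewrite f0.
Qed.

(** A decreasing sequence of closed sets meeting the compact set [P] only in 0 is, within [P],
    eventually inside any given neighbourhood of 0. *)
Lemma countable_separation_base (C : set G) : countable C ->
  (forall f, P f -> (forall x, C x -> dual_fun f x = 0) -> f = 0) ->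
  exists V : nat -> set dual, (forall n, nbhs (0 : dual) (V n)) /\
    forall U, nbhs (0 : dual) U -> exists n, V n `<=` U.
Proof.
move=> cC Csep.
(* Adjoining 0 makes the set nonempty, hence the range of a sequence. *)
have [||c cE] := @countable_surj_nat G (C `|` [set 0]).
- exact/countableU.
- by exists 0; right.
pose B n := [set f : dual | forall i, (i < n)%N ->
  circle_dist (dual_fun f (c i)) <= n.+1%:R^-1].
exists (fun n => P `&` B n); split => [n|U nU].
  apply: filterI => //.
  have cK : compact (c @` `I_n) by apply: finite_compact; exact: finite_image.
  have n0 : 0 < n.+1%:R^-1 :> R by [].
  apply: filterS (nbhs_dual_compact 0 cK n0) => f fK i ni.
  have /fK : (c @` `I_n) (c i) by exists i.
  by rewrite dual0 sub0r circle_distN => /ltW.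
apply: contrapT => nex.
have BS m n : (m <= n)%N -> B n `<=` B m.
  move=> mn f fn i im; apply: le_trans (fn i (leq_trans im mn)) _.
  by rewrite lef_pV2 ?posrE// ler_nat.
have [n||f Pf Qf] := @compact_finite_intersection dual nat P
    (fun n => B n `&` ~` U°) cP.
- apply: closedI; last exact/open_closedC/open_interior.
  rewrite (_ : B n = \bigcap_i [set f | (i < n)%N ->
      circle_dist (dual_fun f (c i)) <= n.+1%:R^-1]); last first.
    apply/seteqP; split => f fB i; first by move=> _; exact: fB.
    exact: (fB i Logic.I).
  apply: closed_bigI => i _.
  exact: (@closed_imply (i < n)%N _ (@closed_dist_le (c i) n.+1%:R^-1)).
- move=> s; apply: contrapT => ns; apply: nex; exists (\max_(i <- s) i)%N.
  move=> f [Pf fB]; apply: contrapT => Uf; apply: ns; exists f => // i si.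
  split; last by move=> /interior_subset.
  by apply: BS fB; exact: (leq_bigmax_seq (F := id)).
- have [_] := Qf 0%N; apply; suff -> : f = 0 by [].
  apply: Csep => // x Cx; have [n _ <-] : range c x by rewrite cE; left.
  apply: circle_dist_eq0; apply/eqP; rewrite eq_le circle_dist_ge0 andbT.
  apply/ler_addgt0Pl => e e0; rewrite addr0.
  have [m me] : exists m, m.+1%:R^-1 < e.
    have := archi_boundP (ltW (_ : 0 < e^-1)); rewrite invr_gt0 => /(_ e0) em.
    exists (Num.bound e^-1); rewrite invf_plt ?posrE//; apply: lt_trans em _.
    by rewrite ltr_nat.
  have [fB _] := Qf (maxn n.+1 m).
  apply: le_trans (fB n _) _; first by rewrite leq_max ltnSn.
  apply: le_trans (ltW me); rewrite lef_pV2 ?posrE// ler_nat ltnS.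
  exact: leq_maxr.
Qed.

Lemma dual_first_countable : frechet_urysohn dual ->
  exists V : nat -> set dual, (forall n, nbhs (0 : dual) (V n)) /\
    forall U, nbhs (0 : dual) U -> exists n, V n `<=` U.
Proof.
move=> fD; have [s0 s0P] := local_subgroup.
(* [N] is closed under sums, so multiples of its members stay in the compact set [P]. *)
pose N := [set f : dual | P f /\ forall x, x \in s0 -> dual_fun f x = 0].
have N0 : N 0 by split => //; exact: nbhs_singleton.
have ND f g : N f -> N g -> N (f + g).
  move=> [Pf fs] [Pg gs]; split; first exact: s0P.
  by move=> x xs; rewrite dual_funD fs// gs// addr0.
have NM f n : N f -> N (f *+ n).
  by move=> Nf; elim: n => [//|n IH]; rewrite mulrS; exact: ND.
have [le [lexx letr lean leto lemin]] := exists_well_order G.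
pose lt e d := ~~ le d e.
have ltle x d e : lt e d -> le d x -> lt e x.
  by move=> ed dx; apply: contra ed; exact: letr.
(* The points at which some character of [N] is nontrivial for the first time; they separate the
   members of [N] from 0. *)
pose I := [set d | exists f : dual,
  [/\ N f, forall e, lt e d -> dual_fun f e = 0 & dual_fun f d <> 0]].
have Isep f : N f -> (forall d, I d -> dual_fun f d = 0) -> f = 0.
  move=> Nf fI; apply: dual_inj; apply: contrapT => /existsNP f0.
  have [d fd dmin] := lemin [set x | dual_fun f x <> 0] f0.
  apply: (fd); apply: fI; exists f; split => // e ed; apply: contrapT => fe.
  by move: ed; rewrite /lt (dmin e fe).
have [cI|uI] := pselect (countable I).
  apply: (@countable_separation_base (I `|` [set` s0])).
    apply: countableU => //; apply: finite_set_countable; exact: finite_seq.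
  move=> f Pf fC; apply: Isep => [|d Id]; last by apply: fC; left.
  by split => // x xs; apply: fC; right.
have [|J [JI uJ Jc]] := @uncountable_initial G lt I _ uI.
  move=> B /lemin[z Bz zB]; exists z => // x Bx.
  by rewrite /lt zB.
(* The list is decreasing, so its head [e] is treated last: adding a multiple of a character trivial
   below [e] leaves the values at the smaller points unchanged. *)
have far (s : seq G) d : sorted (fun x y => le y x) s ->
    (forall e, e \in s -> J e /\ le d e) ->
    exists f, [/\ N f, forall e, lt e d -> dual_fun f e = 0 &
      forall e, e \in s -> 1 / 4 <= circle_dist (dual_fun f e)].
  elim: s => [|e s IH] /= se sJ; first by exists 0; split.
  have [|f [Nf fd fs]] := IH (path_sorted se).
    by move=> e' es; apply: sJ; rewrite inE es orbT.
  have es : forall e', e' \in s -> le e' e.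
    apply/allP; apply: order_path_min se => x y z xy yz; exact: letr xy.
  have [Je de] := sJ e (mem_head _ _).
  have [fe|fe] := leP (1 / 4) (circle_dist (dual_fun f e)).
    by exists f; split => // e'; rewrite inE => /predU1P[->//|]; exact: fs.
  have [psi [Npsi psie psi0]] := JI e Je.
  (* This multiple is farther than 1/2 from the neutral element and [f] moves it by less than 1/4 at
     [e], so the sum stays beyond 1/4. *)
  have /circle_dist_large[n nlarge] : dual_fun psi e != 0 by exact/eqP.
  have ge : 1 / 4 <= circle_dist (dual_fun (f + psi *+ n) e).
    rewrite dual_funD dual_natmul.
    have := circle_distD (dual_fun f e + dual_fun psi e *+ n) (- dual_fun f e).
    rewrite addrAC subrr add0r circle_distN; lra.
  exists (f + psi *+ n); split; first by apply: ND => //; exact: NM.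
    move=> e' ed; rewrite dual_funD dual_natmul fd// psie ?mul0rn ?addr0//.
    exact: ltle ed de.
  move=> e'; rewrite inE => /predU1P[->//|e's].
  have [<-//|ne] := eqVneq e e'.
  rewrite dual_funD dual_natmul psie ?mul0rn ?addr0; first exact: fs.
  apply/negP => ee'; move/eqP: ne; apply; apply: lean.
  by rewrite ee' es.
(* Compactness of [P] extends [far] from finite lists to all of [J] at once. *)
have chiP d : exists f, P f /\ forall e,
    (lt e d -> dual_fun f e = 0) /\
    (J e -> le d e -> 1 / 4 <= circle_dist (dual_fun f e)).
  have [e||f Pf Qf] := @compact_finite_intersection dual G P
    (fun e => [set f | lt e d -> dual_fun f e = 0] `&`
      [set f | J e -> le d e -> 1 / 4 <= circle_dist (dual_fun f e)]) cP.
  - apply: closedI.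
      exact: (@closed_imply (lt e d) _ (@closed_dual_eq0 e)).
    apply: (@closed_imply (J e)).
    exact: (@closed_imply (le d e) _ (@closed_dist_ge e (1 / 4))).
  - move=> s.
    pose t := sort (fun x y => le y x) [seq e <- s | `[<J e>] && le d e].
    have [| |f [[Pf _] fd ft]] := @far t d.
    + by apply: sort_sorted => x y; exact: leto.
    + by move=> e; rewrite mem_sort mem_filter => /andP[/andP[/asboolP]].
    + exists f => // e es; split => [|Je de]; first exact: fd.
      apply: ft; rewrite mem_sort mem_filter es de andbT andbT.
      exact/asboolP.
  - by exists f.
have [chi chiE] := choice chiP.
(* The image under [chi] of the co-countable filter on [J]. *)
pose F : set_system dual := [set M | countable (J `&` [set d | ~ M (chi d)])].
have sub_count (A B : set G) : A `<=` B -> countable B -> countable A.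
  by move=> AB; apply: sub_countable; exact: subset_card_le.
have FI (M : set dual) (A : set G) : countable A ->
    (forall d, J d -> ~ A d -> M (chi d)) -> F M.
  move=> cA AM; apply: sub_count cA => d [Jd nM]; apply: contrapT => nA.
  by apply: nM; exact: AM.
have PF : ProperFilter F.
  split.
    by move=> F0; apply: uJ; apply: sub_count F0 => d Jd; split.
  split.
  - by apply: (FI _ _ (countable0 G)).
  - move=> A B FA FB; apply: (FI _ _ (countableU FA FB)) => d Jd nAB.
    by split; apply: contrapT => nchi; apply: nAB; [left|right].
  - move=> A B AB FA; apply: (FI _ _ FA) => d Jd nA; apply: AB.
    by apply: contrapT => nchi; apply: nA.
have [|f [Pf Ff]] := cP PF.
  by apply: (FI _ _ (countable0 G)) => d _ _; have [] := chiE d.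
(* All but countably many [e] in [J] lie above [d], and for these [chi e] is trivial at [d]. *)
have fJ d : J d -> dual_fun f d = 0.
  move=> Jd; apply: (@closed_dual_eq0 d f) => V nV.
  have [|g [gd Vg]] := Ff [set g | dual_fun g d = 0] V _ nV; last by exists g.
  apply: (FI _ _ (countableU (Jc d Jd) (countable1 d))) => e Je ed.
  have [_ /(_ d)[+ _]] := chiE e; apply.
  apply/negP => ede; apply: ed; have [<-|ne] := eqVneq d e; [by right|left].
  split => //; apply/negP => de; move/eqP: ne; apply; apply: lean.
  by rewrite de ede.
have [|u uJ' uf] := fD f (chi @` J).
  move=> V nV; apply: (Ff _ V _ nV).
  by apply: (FI _ _ (countable0 G)) => d Jd _; exists d.
have /choice[d dP] n : exists d, J d /\ chi d = u n.
  by have [d Jd du] := uJ' n; exists d.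
(* Otherwise [J] would be a countable union of countable initial segments. *)
have [e [Je eu]] : exists e, J e /\ forall n, le (d n) e.
  apply: contrapT => nex; apply: uJ.
  have cU : countable (\bigcup_n [set e | J e /\ lt e (d n)]).
    by apply: bigcup_countable => // n _; apply: Jc; have [] := dP n.
  apply: sub_count cU => e Je; apply: contrapT => ne; apply: nex.
  exists e; split => // n; apply: contrapT => /negP dne; apply: ne.
  by exists n.
have : 1 / 4 <= circle_dist (dual_fun f e).
  apply: (@closed_cvg _ _ \oo _ u [set g | 1 / 4 <= circle_dist (dual_fun g e)]
    (@closed_dist_ge e (1 / 4)) _ f uf).
  apply: nearW => n; have [Jd <-] := dP n.
  by have [_ /(_ e)[_]] := chiE (d n); apply.
rewrite fJ// circle_dist0; lra.
Qed.

End dual_first_countable.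

(** * Sequences under the duality pairing, and the conclusion *)

Lemma compact_cvg_range (X : topologicalType) (u : nat -> X) (a : X) :
  u @ \oo --> a -> compact (a |` range u).
Proof.
move=> ua; rewrite compact_ultra => F UF FK.
have PF : ProperFilter F by exact: ultra_proper.
(* An ultrafilter containing no singleton [[set u n]] avoids every finite part of the sequence, so
   it converges to [a]. *)
have [[n Fn]|nF] := pselect (exists n, F [set u n]).
  exists (u n); split; first by right; exists n.
  by move=> A nA; apply: filterS Fn => _ ->; exact: nbhs_singleton.
exists a; split; first by left.
move=> A nA; have [N _ NA] := ua A nA.
have FN : F (~` (u @` `I_N)).
  elim: N {NA} => [|N IH].
    by rewrite II0 image_set0 setC0; exact: filterT.
  have [FuN|FuN] := in_ultra_setVsetC [set u N] UF; first by case: nF; exists N.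
  apply: filterS (filterI IH FuN) => x [xN xuN] [i /=].
  rewrite ltnS leq_eqVlt => /predU1P[->|iN] ix; first exact: xuN.
  by apply: xN; exists i.
apply: filterS (filterI FK FN) => x [[->|[n _ <-]] xN].
  exact: nbhs_singleton.
by apply: NA => /=; rewrite leqNgt; apply/negP => nN; apply: xN; exists n.
Qed.

Section duality.
Context {R : realType} {G : topologicalZmodType}.

(** The characters [f n] tend to 0 uniformly on the compact set formed by the [x n] and 0. *)
Lemma dual_sequential_eval (x : nat -> G) (f : nat -> dual R G) :
  x @ \oo --> (0 : G) -> f @ \oo --> (0 : dual R G) ->
  exists n, ~ 1 / 4 < circle_dist (dual_fun (f n) (x n)).
Proof.
move=> x0 f0.
have e0 : 0 < 1 / 4 :> R by lra.
have [N _ NK] := f0 _ (nbhs_dual_compact 0 (compact_cvg_range x0) e0).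
exists N; apply/negP; rewrite -leNgt ltW//.
have := NK N (leqnn N) (x N).
by rewrite dual0 sub0r circle_distN; apply; right; exists N.
Qed.

(** The last hypothesis puts [W] inside the polar of [U], which is thus a compact neighbourhood of
    0; its translates give local compactness everywhere. *)
Lemma dual_metrizable_locally_compact (U : set G) (W : set (dual R G)) :
  frechet_urysohn (dual R G) -> nbhs (0 : G) U -> nbhs (0 : dual R G) W ->
  (forall x f, U x -> W f -> ~ 1 / 4 < circle_dist (dual_fun f x)) ->
  metrizable R (dual R G) /\ locally_compact [set: dual R G].
Proof.
move=> fD nU nW UW.
have cP := polar_compact (R := R) nU.
have nP : nbhs (0 : dual R G) (polar U).
  by apply: filterS nW => f Wf x Ux; rewrite leNgt; apply/negP; exact: UW.
split.
  have [V [nV Vb]] := dual_first_countable nP cP fD.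
  exact (@first_countable_metrizable (dual R G) R V
    (@dual_hausdorff R G) nV Vb).
move=> f _; have cfP : compact (+%R f @` polar U).
  apply: continuous_compact cP; apply: continuous_subspaceT => g.
  by move=> A nA; exact: (nbhs_addl nA).
exists (+%R f @` polar U); last first.
  by split => //; exact: compact_closed (@dual_hausdorff R G) cfP.
rewrite withinET; apply/nbhs_shiftP; apply: filterS nP => g Pg /=.
by exists g.
Qed.

End duality.

Theorem theorem10 (R : realType) (G : topologicalZmodType) :
  (productively_frechet G -> frechet_urysohn (dual R G) ->
     metrizable R (dual R G) /\ locally_compact [set: dual R G]) /\
  (frechet_urysohn G -> productively_frechet (dual R G) ->
     metrizable R (dual R G) /\ locally_compact [set: dual R G]).
Proof.
split=> [pG fD|fG pD].
  have [U [W [nU nW UW]]] := nbhs_disjoint_rel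
    (D := fun x f => 1 / 4 < circle_dist (dual_fun f x)) pG fD
    (@dual_sequential_eval R G).
  exact: (dual_metrizable_locally_compact fD nU nW UW).
(* The roles are exchanged: the dual carries the filter and [G] provides the diagonal property. *)
have [W [U [nW nU WU]]] := nbhs_disjoint_rel
  (D := fun f x => 1 / 4 < circle_dist (dual_fun f x)) pD fG
  (fun f x f0 x0 => @dual_sequential_eval R G x f x0 f0).
apply: (dual_metrizable_locally_compact _ nU nW) => [|x f Ux Wf].
  exact: productively_frechet_urysohn.
exact: WU.
Qed.
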